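(* Fix $k\in\mathbb{Z}_{>0}$ and let $n>4k$. Then every distance monoid $R$ with $n$ non-zero elements and Archimedean complexity $n-k$ contains an element $r$ such that $r<2r<\cdots<(n-k)r$.
   Context: A distance monoid is a structure $(R,\oplus,\leq,0)$ such that: $\leq$ is a total order on $R$; $r\leq r\oplus s$ for all $r,s$; if $r\leq t$ and $s\leq u$ then $r\oplus s\leq t\oplus u$; $\oplus$ is commutative and associative; and $r\oplus 0=r$ for all $r$. For $r\in R$, $mr$ denotes the $m$-fold sum $r\oplus\cdots\oplus r$. The Archimedean complexity $\mathrm{arch}(R)$ is the least $p$ such that for all $r_0\leq r_1\leq\cdots\leq r_p$ in $R$, $r_0\oplus r_1\oplus\cdots\oplus r_p=r_1\oplus\cdots\oplus r_p$. *)

(* Defs.v *)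
From HB Require Import structures.
From mathcomp Require Import all_boot all_order.

Set Implicit Arguments.
Unset Strict Implicit.
Unset Printing Implicit Defensive.

Import Order.TTheory.
Local Open Scope order_scope.

Declare Scope dist_scope.
Delimit Scope dist_scope with dist.

(* The total order is inherited from orderType. *)
HB.mixin Record isDistMonoid (d : Order.disp_t) R of Order.Total d R := {
  dadd : R -> R -> R;
  dzero : R;
  le_dadd : forall r s : R, r <= dadd r s;
  dadd_mono : forall r s t u : R, r <= t -> s <= u -> dadd r s <= dadd t u;
  daddC : commutative dadd;
  daddA : associative dadd;
  dadd0 : right_id dzero dadd
}.

#[short(type="distMonoidType")]
HB.structure Definition DistMonoid (d : Order.disp_t) :=
  {R of Order.Total d R & isDistMonoid d R}.

#[short(type="finDistMonoidType")]
HB.structure Definition FinDistMonoid (d : Order.disp_t) :=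
  {R of DistMonoid d R & Finite R}.

Arguments dzero {d s}.

Notation "0" := dzero : dist_scope.
Notation "r + s" := (dadd r s) : dist_scope.
Notation "\sum_ ( m <= i < n ) F" :=
  (\big[dadd/dzero]_(m <= i < n) F%dist) : dist_scope.
Local Open Scope dist_scope.

Lemma dadd0l (d : Order.disp_t) (R : distMonoidType d) :
  left_id (0 : R) (@dadd d R).
Proof. by move=> r; rewrite daddC dadd0. Qed.

HB.instance Definition _ (d : Order.disp_t) (R : distMonoidType d) :=
  Monoid.isComLaw.Build R 0 (@dadd d R) (@daddA d R) (@daddC d R) (@dadd0l d R).

Definition dmul (d : Order.disp_t) (R : distMonoidType d) (m : nat) (r : R) : R :=
  iterop m dadd r 0.

Definition arch_bound (d : Order.disp_t) (R : distMonoidType d) (p : nat) :=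
  forall r : nat -> R,
    (forall i, (i < p)%N -> r i <= r i.+1) ->
    \sum_(0 <= i < p.+1) r i = \sum_(1 <= i < p.+1) r i.

(* A relation rather than a function, since an infinite distance monoid may
   admit no such p. *)
Definition has_arch (d : Order.disp_t) (R : distMonoidType d) (p : nat) :=
  arch_bound R p /\ forall q, arch_bound R q -> (p <= q)%N.

(* Main.v *)
Require Import Defs.
From HB Require Import structures.
From mathcomp Require Import all_boot all_order.
From mathcomp Require Import zify.

Set Implicit Arguments.
Unset Strict Implicit.
Unset Printing Implicit Defensive.

Import Order.TTheory.
Local Open Scope order_scope.

(** Put [p = n - k].  Since complexity [p - 1] fails, there are
    [r_0 <= ... <= r_(p-1)] whose total exceeds the total without [r_0]; then
    adding a new term to any partial sum, in any order, strictly increases it,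
    so every ordering yields a chain of [p] non-zero elements, off which only
    [k] non-zero elements lie.  If [c_j] is the sum of the [j] terms following
    [r_i], then [c_j < c_j + r_i <= c_(j+1)], and the second inequality can be
    strict for at most [k] values of [j]; hence [r_i] may be replaced by
    [r_(i+1)] without changing the total as long as [k + 1] terms follow it.
    This reduces to the case where all but the [k] largest terms equal some
    [r].  Any remaining term [b] is at most [(k+1) r], and the same count
    applied to [b + j r] between consecutive multiples of [r] gives
    [b + k r = (x + k) r] with [x >= 1]; here [p > 3 k] is used.  So the total
    is [Q r] and the total without one [r] is [(Q - 1) r], for some [Q >= p],
    whence [(Q - 1) r < Q r] and all earlier multiples are distinct too. *)

(** * Sums over sequences and irredundancy *)

Section DistMonoidTheory.
Context {d : Order.disp_t} {R : distMonoidType d}.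
Implicit Types (a b x : R) (l s t : seq R).
Local Open Scope dist_scope.

Definition dsum l : R := \big[dadd/0]_(x <- l) x.

Lemma dsum_nil : dsum [::] = 0. Proof. exact: big_nil. Qed.
Lemma dsum_cons x l : dsum (x :: l) = x + dsum l. Proof. exact: big_cons. Qed.
Lemma dsum_cat s t : dsum (s ++ t) = dsum s + dsum t.
Proof. exact: big_cat. Qed.
Lemma dsum_perm s t : perm_eq s t -> dsum s = dsum t.
Proof. exact: perm_big. Qed.

Lemma daddCA : left_commutative (@dadd d R).
Proof. exact: Monoid.mulmCA. Qed.

Lemma le_dadd2r x a b : a <= b -> a + x <= b + x.
Proof. by move=> ab; apply: dadd_mono. Qed.

Lemma le_daddl a b : a <= b + a.
Proof. by rewrite daddC le_dadd. Qed.

Lemma dmulS m a : dmul m.+1 a = a + dmul m a.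
Proof. by case: m => [|m] //; rewrite /dmul /= dadd0. Qed.

Lemma dmulD m n a : dmul (m + n) a = dmul m a + dmul n a.
Proof.
elim: m => [|m IH]; first by rewrite add0n dadd0l.
by rewrite addSn !dmulS IH daddA.
Qed.

Lemma dsum_nseq m a : dsum (nseq m a) = dmul m a.
Proof. by elim: m => [|m IH]; rewrite ?dsum_nil // dsum_cons IH dmulS. Qed.

Lemma dmul_le m n a : (m <= n)%N -> dmul m a <= dmul n a.
Proof. by move=> /subnKC <-; rewrite dmulD le_dadd. Qed.

Lemma dmul_stable m n a : (m <= n)%N ->
  dmul m.+1 a = dmul m a -> dmul n.+1 a = dmul n a.
Proof.
by move=> /subnKC <- E; rewrite -addSn !dmulD E.
Qed.

(* [a :: l] is a witness that the Archimedean complexity exceeds [size l]. *)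
Definition irredundant a l :=
  all (>= a) l && (a + dsum l != dsum l).

(** If [s] absorbed [x], the total would equal the sum without [x]. That is at most the sum without
    the minimal term [a], so [a] would be redundant. *)
Lemma irredundant_lt a l x s t : irredundant a l ->
  perm_eq (a :: l) (x :: s ++ t) -> dsum s < x + dsum s.
Proof.
move=> /andP[al neq] pm; rewrite lt_neqAle le_daddl andbT.
apply: contraNneq neq => E.
have Est : dsum (s ++ t) = a + dsum l.
  by rewrite -dsum_cons (dsum_perm pm) dsum_cons dsum_cat daddA -E.
apply/eqP/le_anti; rewrite le_daddl andbT -Est.
have [eqax|neax] := eqVneq a x.
  by move: pm; rewrite -eqax perm_cons => /dsum_perm ->.
have ast : a \in s ++ t.
  by move: (perm_mem pm a); rewrite !inE eqxx (negPf neax).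
have pst := perm_to_rem ast; set w := rem a _ in pst.
have plw : perm_eq l (x :: w).
  rewrite -(perm_cons a); apply: perm_trans pm _.
  apply: (@perm_trans _ (x :: a :: w)); first by rewrite perm_cons.
  exact/permPl/(perm_catCA [:: x] [:: a] w).
rewrite (dsum_perm pst) (dsum_perm plw) !dsum_cons le_dadd2r //.
by apply: (allP al); rewrite (perm_mem plw) mem_head.
Qed.

Lemma irredundant_prefix_lt a l s : irredundant a l -> perm_eq (a :: l) s ->
  forall i, (i < size s)%N -> dsum (take i s) < dsum (take i.+1 s).
Proof.
move=> ir pm i lt_i; rewrite (take_nth 0) // -cats1 dsum_cat daddC.
rewrite dsum_cons dsum_nil dadd0.
apply: (@irredundant_lt a l _ _ (drop i.+1 s)) ir _.
apply: perm_trans pm _; rewrite -[X in perm_eq X](cat_take_drop i).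
by rewrite (drop_nth 0) // perm_catC /= perm_cons perm_catC.
Qed.

End DistMonoidTheory.

(** * Rank and strict chains in a finite monoid *)

Section FiniteCounting.
Context {d : Order.disp_t} {R : finDistMonoidType d}.
Implicit Types (a b x : R) (l s t : seq R).
Local Open Scope dist_scope.

Definition rank x := #|[set y : R | y < x]|.

Lemma rank_lt x y : x < y -> (rank x < rank y)%N.
Proof.
move=> xy; apply/proper_card/properP; split; last first.
  by exists x; rewrite inE ?ltxx.
by apply/subsetP => z; rewrite !inE => /lt_trans; apply.
Qed.

Lemma rank_max x : (rank x < #|R|)%N.
Proof.
rewrite -cardsT; apply/proper_card/properP; split; first exact: subsetT.
by exists x; rewrite ?inE ?ltxx.
Qed.

Lemma rank_chain (f : nat -> R) i q :
  (forall j, (i <= j < i + q)%N -> f j < f j.+1) ->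
  (rank (f i) + q <= rank (f (i + q)%N))%N.
Proof.
elim: q => [|q IH] lt_f; first by rewrite !addn0.
have /IH : forall j, (i <= j < i + q)%N -> f j < f j.+1.
  by move=> j hj; apply: lt_f; lia.
have := rank_lt (lt_f (i + q)%N _); rewrite -addnS => /(_ ltac:(lia)).
lia.
Qed.

Lemma rank_chain_interleaved (f g : nat -> R) i q :
  (forall j, (j < q)%N -> f (i + j)%N < g j < f (i + j).+1) ->
  (rank (f i) + q.*2 <= rank (f (i + q)%N))%N.
Proof.
elim: q => [|q IH] lt_f; first by rewrite !addn0.
have /IH : forall j, (j < q)%N -> f (i + j)%N < g j < f (i + j).+1.
  by move=> j hj; apply: lt_f; lia.
have /andP[/rank_lt h1 /rank_lt h2] := lt_f q (ltnSn q).
by rewrite addnS; lia.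
Qed.

(* At most [k] non-zero elements lie off a strict chain of length [p] from 0. *)
Lemma chain_interleaving_bound (f g : nat -> R) p k i :
  (#|R| <= p + k.+1)%N -> (i + k < p)%N ->
  (forall j, (j < p)%N -> f j < f j.+1) ->
  (forall j, (j <= k)%N -> f (i + j)%N <= g j <= f (i + j).+1) ->
  exists2 j, (j <= k)%N & g j = f (i + j)%N \/ g j = f (i + j).+1.
Proof.
move=> cR lt_p lt_f le_g.
pose P j := (g j == f (i + j)%N) || (g j == f (i + j).+1).
have [/hasP[j]|/hasPn nP] := boolP (has P (iota 0 k.+1)).
  rewrite mem_iota => hj /orP E; exists j; first by lia.
  by case: E => /eqP; [left | right].
have lt_g j : (j < k.+1)%N -> f (i + j)%N < g j < f (i + j).+1.
  move=> hj; have /norP[n1 n2] : ~~ P j by apply: nP; rewrite mem_iota; lia.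
  have /andP[h1 h2] := le_g j hj.
  by rewrite !lt_neqAle h1 h2 n2 eq_sym n1.
have h1 := rank_chain_interleaved lt_g.
have h2 : (rank (f 0%N) + i <= rank (f (0 + i)%N))%N.
  by apply: rank_chain => j hj; apply: lt_f; lia.
have h3 : (rank (f (i + k.+1)%N) + (p - (i + k.+1)) <=
           rank (f (i + k.+1 + (p - (i + k.+1)))%N))%N.
  by apply: rank_chain => j hj; apply: lt_f; lia.
rewrite subnKC in h3; last by lia.
rewrite add0n in h2.
have := rank_max (f p); lia.
Qed.

(** * Exchanging small terms for larger ones *)

(* If every sum [c_j + a], with [c_j] the [j]-th partial sum of [b :: l], were
   strictly between [c_j] and [c_(j+1)], there would be too many elements. *)
Lemma exchange k m a b l :
  (#|R| <= (m + size (b :: l)).+1 + k.+1)%N -> (k < size (b :: l))%N ->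
  irredundant a (nseq m a ++ b :: l) -> path <=%O b l ->
  a + dsum (b :: l) = b + dsum (b :: l).
Proof.
move=> cR ltk ir pbl.
have ab : a <= b.
  by case/andP: ir => /allP/(_ b) + _; apply; rewrite mem_cat mem_head orbT.
(* The larger terms come first, so each of the first [k.+1] increments is at least [b]. *)
pose s := (b :: l) ++ nseq m.+1 a.
have pm : perm_eq (a :: nseq m a ++ b :: l) s.
  by rewrite -[a :: _]/(nseq m.+1 a ++ b :: l) perm_catC.
have ss : size s = (m + size (b :: l)).+1.
  by rewrite size_cat size_nseq addnS addnC.
have le_nth j : (j <= k)%N -> b <= nth 0 s j.
  move=> hj; rewrite nth_cat (leq_ltn_trans hj ltk).
  move: pbl; rewrite (path_sortedE le_trans) => /andP[/allP h _].
  have := mem_nth 0 (leq_ltn_trans hj ltk).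
  by rewrite inE => /predU1P[-> //|/h].
have takeS j : (j <= k)%N -> dsum (take j.+1 s) = nth 0 s j + dsum (take j s).
  move=> hj; rewrite (take_nth 0) ?ss; last by lia.
  by rewrite -cats1 dsum_cat dsum_cons dsum_nil dadd0 daddC.
have [||||j hj E] := @chain_interleaving_bound
  (fun j => dsum (take j s)) (fun j => a + dsum (take j s)) (size s) k 0.
- by rewrite ss.
- by rewrite ss; lia.
- exact: irredundant_prefix_lt ir pm.
- move=> j hj; rewrite add0n le_daddl takeS // le_dadd2r //.
  exact: le_trans ab (le_nth j hj).
have Es : take j (b :: l) = take j s.
  by rewrite take_cat ifT //; lia.
have E' : a + dsum (take j s) = b + dsum (take j s).
  apply/le_anti; rewrite le_dadd2r //=.
  (* By irredundancy [a] cannot leave the partial sum unchanged, so adding [a] reaches the next one,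
     which gains at least [b]. *)
  case: E; rewrite add0n => E; last by rewrite E takeS // le_dadd2r ?le_nth.
  have := @irredundant_lt _ _ a _ a (take j s) (drop j (b :: l) ++ nseq m a) ir.
  rewrite E ltxx -Es catA cat_take_drop perm_cons perm_catC perm_refl.
  by move=> /(_ isT).
rewrite -(cat_take_drop j (b :: l)) dsum_cat !daddA Es.
by rewrite E'.
Qed.

(** Next to [b :: l] each copy of [a] can be traded for [b], so the sums with and without one
    minimal term both keep their values. *)
Lemma irredundant_exchange k m a b l :
  (#|R| <= (m + size (b :: l)).+1 + k.+1)%N -> (k < size (b :: l))%N ->
  irredundant a (nseq m a ++ b :: l) -> path <=%O b l ->
  irredundant b (nseq m.+1 b ++ l).
Proof.
move=> cR ltk ir pbl; have E := exchange cR ltk ir pbl.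
have Em i : dmul i a + dsum (b :: l) = dmul i b + dsum (b :: l).
  elim: i => // i IH; rewrite !dmulS -!daddA IH daddCA E.
  by rewrite daddCA.
apply/andP; split.
  rewrite all_cat all_nseq lexx orbT /=.
  by move: pbl; rewrite (path_sortedE le_trans) => /andP[].
case/andP: ir => _; apply: contraNneq => H.
have Eb : dsum (nseq m.+1 b ++ l) = dmul m b + dsum (b :: l).
  by rewrite dsum_cat dsum_nseq dsum_cons dmulS -daddA daddCA.
rewrite dsum_cat dsum_nseq daddA -dmulS !Em dmulS -daddA.
by rewrite -Eb H.
Qed.

Lemma irredundant_nseq k p a l :
  (#|R| <= p + k.+1)%N -> (size l).+1 = p -> (k < p)%N ->
  irredundant a l -> sorted <=%O l ->
  exists b t, [/\ size t = k & irredundant b (nseq (p - k).-1 b ++ t)].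
Proof.
move=> cR sl ltk ir sol.
suff H : forall l m a, (m + size l).+1 = p -> (k <= size l)%N ->
    irredundant a (nseq m a ++ l) -> sorted <=%O l ->
    exists b t, [/\ size t = k & irredundant b (nseq (p - k).-1 b ++ t)].
  by apply: (H l 0%N a) => //; lia.
elim=> {sl ir sol}[|b l' IH] m {}a /= sl lek ir sol.
  exists a, [::]; split; first by rewrite /=; lia.
  by have -> : (p - k).-1 = m by lia.
have [Ek|ltk'] := eqVneq k (size l').+1.
  exists a, (b :: l'); split=> //.
  by have -> : (p - k).-1 = m by lia.
apply: (IH m.+1 b).
- by lia.
- by lia.
- apply: (irredundant_exchange (k := k)) ir sol; last by rewrite /=; lia.
  by apply: leq_trans cR _; rewrite /=; lia.
- exact: path_sorted sol.
Qed.

(** * Absorbing the largest terms into multiples *)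

Lemma irredundant_absorb k p a b t :
  (#|R| <= p + k.+1)%N -> (3 * k < p)%N -> size t = k ->
  irredundant a (nseq (p - k).-1 a ++ t) -> b \in t ->
  exists2 x, (0 < x)%N & b + dmul k a = dmul (x + k) a.
Proof.
move=> cR ltp st ir bt.
pose s := nseq (p - k) a ++ t.
have Es : s = a :: nseq (p - k).-1 a ++ t.
  by rewrite /s; case: (p - k)%N (ltac:(lia) : (0 < p - k)%N).
have pm : perm_eq (a :: nseq (p - k).-1 a ++ t) s by rewrite Es.
have ss : size s = p by rewrite size_cat size_nseq st; lia.
have bs : b \in s by rewrite mem_cat bt orbT.
have ab : a <= b.
  by case/andP: ir => /allP/(_ b) + _; apply; rewrite mem_cat bt orbT.
have fs j : (j <= p - k)%N -> dsum (take j s) = dmul j a.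
  move=> hj; rewrite take_cat size_nseq; case: ltnP => h.
    by rewrite take_nseq // dsum_nseq.
  have -> : j = (p - k)%N by lia.
  by rewrite subnn take0 cats0 dsum_nseq.
have lt_f := irredundant_prefix_lt ir pm; rewrite ss in lt_f.
(* With [b] placed first, the other [p.-1] terms give as many strict increases above [b], leaving
   little room below it. *)
have rkb : (rank b <= k.+1)%N.
  have pmb := perm_to_rem bs; set w := rem b s in pmb.
  have lt_w := irredundant_prefix_lt ir (perm_trans pm pmb).
  have sw : size (b :: w) = p by rewrite -(perm_size pmb).
  have h : (rank (dsum (take 1 (b :: w))) + p.-1 <=
            rank (dsum (take (1 + p.-1) (b :: w))))%N.
    apply: (@rank_chain (fun j => dsum (take j (b :: w)))) => j hj.
    by apply: lt_w; rewrite sw; lia.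
  move: h; rewrite /= take0 dsum_cons dsum_nil dadd0 => h.
  by have := leq_trans (leq_ltn_trans h (rank_max _)) cR; lia.
have bk : b <= dmul k.+1 a.
  rewrite leNgt; apply/negP => /rank_lt.
  have : (rank (dsum (take 0 s)) + k.+1 <= rank (dsum (take (0 + k.+1) s)))%N.
    apply: (@rank_chain (fun j => dsum (take j s))) => j hj.
    by apply: lt_f; lia.
  by rewrite add0n (fs k.+1); lia.
(* Setting this case aside ensures [x <= k] below. The multiples compared then go up to at most
   [2k + 1 <= p - k], so [fs] identifies them with prefix sums. *)
have [->|nbk] := eqVneq b (dmul k.+1 a).
  by exists k.+1 => //; rewrite dmulD.
have {nbk}bk : b < dmul k.+1 a by rewrite lt_neqAle nbk.
have exP : exists i, dmul i a <= b by exists 1%N.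
have ubP i : dmul i a <= b -> (i <= k)%N.
  move=> h; rewrite leqNgt; apply/negP => /(dmul_le a) h'.
  by have := lt_le_trans bk (le_trans h' h); rewrite ltxx.
case: (ex_maxnP exP ubP) => x xb max_x.
have x0 : (0 < x)%N by apply: max_x.
have xk := ubP _ xb.
have bx : b <= dmul x.+1 a.
  by rewrite leNgt; apply/negP => /ltW/max_x; rewrite ltnn.
have [|||j hj] := @chain_interleaving_bound
  (fun j => dsum (take j s)) (fun j => b + dmul j a) p k x cR.
- by lia.
- exact: lt_f.
- move=> j hj; rewrite !fs; try lia.
  by rewrite -addSn !dmulD !le_dadd2r.
have Ek y : b + dmul j a = dmul (y + j) a -> b + dmul k a = dmul (y + k) a.
  by move=> E; rewrite -(subnKC hj) !dmulD daddA E dmulD -daddA.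
rewrite !fs; try lia.
case=> E; first by exists x => //; apply: Ek.
by exists x.+1 => //; apply: Ek.
Qed.

(** The same [k] copies of [a] serve for each term of [t] in turn. *)
Lemma dsum_absorb k a t :
  (forall b, b \in t ->
     exists2 x, (0 < x)%N & b + dmul k a = dmul (x + k) a) ->
  exists2 y, (size t <= y)%N & dsum t + dmul k a = dmul (y + k) a.
Proof.
elim: t => [|b t IH] H; first by exists 0%N => //; rewrite dsum_nil dadd0l.
have [|y hy Ey] := IH; first by move=> c ct; apply: H; rewrite inE ct orbT.
have [x hx Ex] := H b (mem_head _ _).
exists (x + y)%N; first by move=> /=; lia.
by rewrite dsum_cons -daddA Ey dmulD daddCA Ex -dmulD addnA (addnC y).
Qed.

Lemma irredundant_multiples k p a l :
  (#|R| <= p + k.+1)%N -> (3 * k < p)%N -> (size l).+1 = p ->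
  irredundant a l -> sorted <=%O l ->
  exists r : R, forall i, (i < p)%N -> dmul i r < dmul i.+1 r.
Proof.
move=> cR ltp sl ir sol.
have [|b [t [st irb]]] := irredundant_nseq cR sl _ ir sol; first by lia.
have [|y hy Ey] := @dsum_absorb k b t.
  by move=> c; apply: irredundant_absorb irb.
exists b => i hi; rewrite lt_neqAle dmul_le // andbT.
case/andP: irb => _; apply: contraNneq => E.
have -> : dsum (nseq (p - k).-1 b ++ t) = dmul ((p - k).-1 + y)%N b.
  have -> : (p - k).-1 = ((p - k).-1 - k + k)%N by lia.
  rewrite dsum_cat dsum_nseq dmulD -daddA [dmul k b + _]daddC Ey -!dmulD.
  by congr dmul; lia.
(* Since [y >= k], the multiplier is at least [p - 1 >= i], so equality at [i] propagates to it. *)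
rewrite -dmulS (dmul_stable (m := i)) //; lia.
Qed.

End FiniteCounting.

(** * Deduction from the Archimedean complexity *)

Theorem theorem4p3 (k n : nat) (hk : (0 < k)%N) (hn : (4 * k < n)%N)
    (d : Order.disp_t) (R : finDistMonoidType d)
    (hcard : #|[set r : R | r != dzero]| = n)
    (harch : has_arch R (n - k)) :
  exists r : R, forall i : nat,
    (1 <= i)%N -> (i < n - k)%N -> dmul i r < dmul i.+1 r.
Proof.
have cR : (#|R| <= (n - k) + k.+1)%N.
  apply: leq_trans (leqSpred _) _; rewrite -(cardsC1 (dzero : R)).
  have -> : [set~ dzero] = [set r : R | r != dzero].
    by apply/setP => r; rewrite !inE.
  by rewrite hcard; lia.
pose P (r : R) := all (fun i => dmul i r < dmul i.+1 r) (iota 0 (n - k)).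
have [/existsP[r /allP Pr]|nP] := boolP [exists r, P r].
  by exists r => i _ hi; apply: Pr; rewrite mem_iota.
(* If no such [r] exists, the bound [(n - k).-1] holds, against minimality: a sequence violating it
   is irredundant and yields [r]. *)
case: harch => _ /(_ (n - k).-1).
suff /[swap] /[apply] : arch_bound R (n - k).-1 by lia.
move=> r le_r; apply/eqP; apply: contraNT nP; rewrite big_ltn // => neq.
have le_r' i j : (i <= j)%N -> (j <= (n - k).-1)%N -> r i <= r j.
  move=> /subnKC <-; elim: (j - i)%N => [|m IH] hm; first by rewrite addn0.
  by rewrite addnS (le_trans (IH _)) ?le_r //; lia.
pose l := map r (iota 1 (n - k).-1).
have [|||||s Ps] := @irredundant_multiples _ R k (n - k) (r 0%N) l.
- exact: cR.
- by lia.
- by rewrite size_map size_iota; lia.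
- apply/andP; split.
    rewrite all_map; apply/allP => i /=; rewrite mem_iota => hi.
    by apply: le_r'; lia.
  by rewrite /dsum big_map; move: neq; rewrite /index_iota subSS subn0.
- apply: (homo_sorted_in (P := [pred i | (i <= (n - k).-1)%N]) (e := leq)).
  + by move=> i j _ hj ij; apply: le_r'.
  + by apply/allP => i; rewrite mem_iota /=; lia.
  + exact: iota_sorted.
by apply/existsP; exists s; apply/allP => i; rewrite mem_iota => hi; apply: Ps.
Qed.
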